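(* Let $X$ be an $L_1$-predual space. Then the map $F\mapsto\mathrm{cent}_{X}(F)$ is $2$-Lipschitz continuous on the class of non-empty compact subsets of $X$ in the Hausdorff metric, i.e. $d_{H}(\mathrm{cent}_{X}(F_1),\mathrm{cent}_{X}(F_2))\le 2\,d_{H}(F_1,F_2)$ for all non-empty compact $F_1,F_2\subseteq X$. Moreover, in general, the constant $2$ is the best possible Lipschitz constant, i.e. no constant smaller than $2$ works for all $L_1$-predual spaces.
   Context: All Banach spaces are real. A Banach space $X$ is an $L_1$-predual space if its dual $X^{\ast}$ is isometric to $L_{1}(\mu)$ for some positive measure $\mu$. For a non-empty closed bounded $B\subseteq X$ and $x\in X$, put $r(x,B)=\sup\{\|x-b\|:b\in B\}$, $\mathrm{rad}_{X}(B)=\inf_{x\in X}r(x,B)$, and $\mathrm{cent}_{X}(B)=\{x\in X:r(x,B)=\mathrm{rad}_{X}(B)\}$; in an $L_1$-predual space $\mathrm{cent}_{X}(F)\ne\emptyset$ for every non-empty compact $F\subseteq X$. The Hausdorff metric on non-empty closed bounded subsets of $X$ is $d_{H}(B_1,B_2)=\inf\{a>0: B_1\subseteq B_2+aB(0,1),\ B_2\subseteq B_1+aB(0,1)\}$, where $B(0,1)$ is the open unit ball of $X$. *)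

(* Defs.v *)
From HB Require Import structures.
From mathcomp Require Import all_boot all_order all_algebra.
From mathcomp Require Import all_classical all_reals all_analysis.

Set Implicit Arguments.
Unset Strict Implicit.
Unset Printing Implicit Defensive.

Import Order.TTheory GRing.Theory Num.Theory.
Import numFieldNormedType.Exports.

Local Open Scope classical_set_scope.
Local Open Scope ring_scope.

Definition dual (R : realType) (X : normedModType R) : set (X -> R) :=
  [set f : X -> R | scalar f /\ continuous f].

Definition dual_norm (R : realType) (X : normedModType R) (f : X -> R) : R :=
  sup [set `|f x| | x in [set x : X | `|x| <= 1]].

(* [LspaceType1 mu] is the quotient of the integrable functions by equality
   almost everywhere. The library gives it no vector space structure, so
   linearity is stated on representatives. Injectivity of [Phi] follows from
   linearity and norm preservation. *)
Definition L1_isometry (R : realType) (X : normedModType R)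
    (d : measure_display) (T : measurableType d)
    (mu : {measure set T -> \bar R})
    (Phi : (X -> R) -> LspaceType1 mu) : Prop :=
  [/\ forall (a : R) (f g : X -> R), dual f -> dual g ->
        (Phi (fun x => a * f x + g x) : T -> R)
          = (fun t => a * Phi f t + Phi g t) %[ae mu],
      forall f : X -> R, dual f ->
        'N[mu]_1[EFin \o (Phi f : T -> R)]%E = (dual_norm f)%:E
    & forall h : LspaceType1 mu, exists2 f : X -> R, dual f & Phi f = h].

(* [mu] is arbitrary: neither finiteness nor sigma-finiteness is assumed. *)
Definition L1_predual (R : realType) (X : completeNormedModType R) : Prop :=
  exists (d : measure_display) (T : measurableType d)
    (mu : {measure set T -> \bar R}) (Phi : (X -> R) -> LspaceType1 mu),
  L1_isometry Phi.

Definition farthest (R : realType) (X : normedModType R)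
    (x : X) (B : set X) : R :=
  sup [set `|x - b| | b in B].

Definition rad (R : realType) (X : normedModType R) (B : set X) : R :=
  inf [set farthest x B | x in [set: X]].

Definition cent (R : realType) (X : normedModType R) (B : set X) : set X :=
  [set x | farthest x B = rad B].

Definition enlarge (R : realType) (X : normedModType R)
    (B : set X) (a : R) : set X :=
  [set b + a *: u | b in B & u in ball (0 : X) 1].

(* Extended-real valued so that the infimum of an empty set of radii is +oo
   instead of the default value 0; on non-empty bounded sets it is finite. *)
Definition hausdorff_dist (R : realType) (X : normedModType R)
    (B1 B2 : set X) : \bar R :=
  ereal_inf [set a%:E | a in
    [set a : R | [/\ 0 < a, B1 `<=` enlarge B2 a & B2 `<=` enlarge B1 a]]].

Definition cent_lipschitz (R : realType) (X : normedModType R) (c : R) :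
    Prop :=
  forall F1 F2 : set X,
    compact F1 -> F1 !=set0 -> compact F2 -> F2 !=set0 ->
    (hausdorff_dist (cent F1) (cent F2) <= c%:E * hausdorff_dist F1 F2)%E.

(* Main.v *)
(* A minimal sublinear functional is linear, which gives Hahn-Banach; applied on
   [X^n] to the gauge of families of balls meeting in a point, it reduces the
   approximate intersection of balls [B(x_i, r_i)] to the inequality
   [sum_i f_i(x_i) <= sum_i r_i |f_i|] for functionals with [sum_i f_i = 0].
   In [X^* = L_1] the mass of the positive parts of the [f_i] can be transported
   onto the negative parts: [f_i = sum_j (h_ij - h_ji)] with [h_ij >= 0] and
   [|f_i| = sum_j (|h_ij| + |h_ji|)], so the inequality follows from
   [|x_i - x_j| <= r_i + r_j]. A net and a geometric iteration then give a point
   [y] with [|y - z| <= r] on a compact [F] and [|y - x| <= s + e] as soon as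
   [F] has diameter at most [2r] and [|x - z| <= r + s] on [F].
   If [x] is a center of [F1] and [d_H(F1, F2) < a], the radii differ by at most
   [a], so [|x - z| <= rad F2 + 2a] on [F2] and a center of [F2] lies within
   [2a + e] of [x].
   For optimality, in the plane with the sup norm take [F1 = {(0,0)}] and
   [F2 = {(1,1), (-1,1)}]: [d_H(F1, F2) = 1], [cent F1 = {(0,0)}], and
   [cent F2] contains [(0,2)]. *)
From HB Require Import structures.
From mathcomp Require Import all_boot all_order all_algebra.
From mathcomp Require Import all_classical all_reals all_analysis.
From mathcomp Require Import measurable_realfun.
From mathcomp Require Import finmap lra ring.
Require Import Defs.

Set Implicit Arguments.
Unset Strict Implicit.
Unset Printing Implicit Defensive.

Import Order.TTheory GRing.Theory Num.Theory.
Import numFieldNormedType.Exports.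

Local Open Scope classical_set_scope.
Local Open Scope ring_scope.

(** * Hahn-Banach *)

Lemma le_add_inf (R : realType) (A B : set R) (c : R) :
  A !=set0 -> B !=set0 -> (forall s t, A s -> B t -> c <= s + t) ->
  c <= inf A + inf B.
Proof.
move=> A0 B0 h; rewrite -lerBlDr; apply: lb_le_inf => // s As.
rewrite lerBlDr addrC -lerBlDr; apply: lb_le_inf => // t Bt.
by rewrite lerBlDr addrC; exact: h.
Qed.

Section HahnBanach.
Context {R : realType} {V : lmodType R}.
Implicit Types (p q : V -> R).

(** Homogeneity is asked only as an inequality, which is what infima yield directly; [sublinearZ]
    recovers equality by scaling back with [a^-1]. *)
Definition sublinear p :=
  (forall x y, p (x + y) <= p x + p y) /\
  (forall a x, 0 <= a -> p (a *: x) <= a * p x).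

Lemma sublinear0 p : sublinear p -> p 0 = 0.
Proof.
move=> [pD pZ]; apply/eqP; rewrite eq_le; apply/andP; split.
  by have := pZ 0 0 (lexx _); rewrite scaler0 mul0r.
by have := pD 0 0; rewrite addr0 -subr_ge0 addrK.
Qed.

Lemma sublinearZ p a x : sublinear p -> 0 <= a -> p (a *: x) = a * p x.
Proof.
move=> sp; rewrite le_eqVlt => /predU1P[<-|a0].
  by rewrite scale0r mul0r sublinear0.
apply/eqP; rewrite eq_le sp.2 ?(ltW a0)//= -ler_pdivlMl//.
by rewrite -{1}(scalerK (lt0r_neq0 a0) x) sp.2// invr_ge0 ltW.
Qed.

(** The bound is independent of [q], so pointwise infima of sublinear functionals below [p] are
    finite. *)
Lemma sublinear_geN p q x : sublinear q -> (forall x, q x <= p x) ->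
  - p (- x) <= q x.
Proof.
move=> sq qp; rewrite lerNl.
have := sq.1 x (- x); rewrite subrr sublinear0// -lerBlDl sub0r.
by move=> /le_trans; apply.
Qed.

Lemma minimal_sublinear p : sublinear p ->
  exists q, [/\ sublinear q, forall x, q x <= p x &
    forall q', sublinear q' -> (forall x, q' x <= q x) -> q' = q].
Proof.
move=> sp.
pose D := {q : V -> R | sublinear q /\ forall x, q x <= p x}.
(* The order is reversed, so that a maximal element in Zorn's lemma is a pointwise minimal
   functional. *)
pose le_D (q1 q2 : D) := `[< forall x, sval q2 x <= sval q1 x >].
have [||||q qmin] := @Zorn D le_D.
- by move=> q; apply/asboolP.
- move=> q1 q2 q3 /asboolP h1 /asboolP h2; apply/asboolP => x.
  exact: le_trans (h1 x).
- move=> [q1 h1] [q2 h2] /asboolP /= h12 /asboolP /= h21.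
  by apply/eq_exist/funext => x; apply/eqP; rewrite eq_le h21 h12.
- move=> A totA.
  have [[q0 Aq0]|A0] := pselect (A !=set0); last first.
    exists (exist _ p (conj sp (fun x => lexx (p x)))) => q Aq.
    by exfalso; apply: A0; exists q.
  pose vals x := [set sval q x | q in A].
  have vals0 x : vals x !=set0 by exists (sval q0 x), q0.
  have lbv x : has_lbound (vals x).
    exists (- p (- x)) => _ [[q [sq qp]] _ <-] /=; exact: sublinear_geN.
  have lev (q : D) x : A q -> inf (vals x) <= sval q x.
    by move=> Aq; apply: ge_inf => //; exists q.
  have sm : sublinear (fun x => inf (vals x)).
    split=> [x y|a x a0].
      apply: le_add_inf => // _ _ [q1 Aq1 <-] [q2 Aq2 <-].
      (* In a chain, the smaller of [q1] and [q2] can be used at both [x] and [y]. *)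
      have [/asboolP h|/asboolP h] := totA _ _ Aq1 Aq2.
        apply: le_trans (lev q2 _ Aq2) _.
        by apply: le_trans ((svalP q2).1.1 _ _) _; rewrite lerD2r.
      apply: le_trans (lev q1 _ Aq1) _.
      by apply: le_trans ((svalP q1).1.1 _ _) _; rewrite lerD2l.
    move: a0; rewrite le_eqVlt => /predU1P[<-|a0].
      rewrite scale0r mul0r; apply: le_trans (lev q0 _ Aq0) _.
      by rewrite sublinear0//; exact: (svalP q0).1.
    rewrite -ler_pdivrMl//; apply: lb_le_inf => // _ [q Aq <-].
    rewrite ler_pdivrMl// -sublinearZ ?(ltW a0)//; last exact: (svalP q).1.
    exact: lev.
  have mp x : inf (vals x) <= p x.
    exact: le_trans (lev q0 x Aq0) ((svalP q0).2 x).
  exists (exist _ (fun x => inf (vals x)) (conj sm mp)) => q Aq.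
  by apply/asboolP => x; exact: lev.
exists (sval q); split; [exact: (svalP q).1|exact: (svalP q).2|].
move=> q' sq' q'q.
have q'p x : q' x <= p x by exact: le_trans (q'q x) ((svalP q).2 x).
by rewrite -(qmin (exist _ q' (conj sq' q'p)))//; apply/asboolP.
Qed.

(* [tilt q x0] is a sublinear functional below [q] with value at most [- q x0]
   at [- x0]; a minimal [q] equals all its tilts, hence is odd, hence linear. *)
Definition tilt q x0 y :=
  inf [set q (y + t *: x0) - t * q x0 | t in [set t | 0 <= t]].

Lemma tilt_le q x0 y t : sublinear q -> 0 <= t ->
  tilt q x0 y <= q (y + t *: x0) - t * q x0.
Proof.
move=> sq t0; apply: ge_inf; last by exists t.
(* This is a lower bound because [s * q x0 = q (s *: x0) <= q (y + s *: x0) + q (- y)]. *)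
exists (- q (- y)) => _ [s /= s0 <-].
rewrite -sublinearZ// lerBrDr addrC lerBlDr.
by have := sq.1 (y + s *: x0) (- y); rewrite addrC addKr.
Qed.

(** The parameter [s + t] serves for a sum and [a * t] for a dilation by [a]. *)
Lemma tilt_sublinear q x0 : sublinear q -> sublinear (tilt q x0).
Proof.
move=> sq.
have ne y : [set q (y + t *: x0) - t * q x0 | t in [set t | 0 <= t]] !=set0.
  by exists (q (y + 0 *: x0) - 0 * q x0), 0 => /=.
split=> [x y|a x a0].
  apply: le_add_inf => // _ _ [s /= s0 <-] [t /= t0 <-].
  apply: le_trans (@tilt_le _ _ _ (s + t) sq _) _; first exact: addr_ge0.
  rewrite addrACA -opprD -mulrDl lerD2r scalerDl addrACA; exact: sq.1.
move: a0; rewrite le_eqVlt => /predU1P[<-|a0].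
  rewrite scale0r mul0r; apply: le_trans (tilt_le _ _ sq (lexx _)) _.
  by rewrite scale0r addr0 mul0r subr0 sublinear0.
rewrite -ler_pdivrMl//; apply: lb_le_inf => // _ [t /= t0 <-].
rewrite ler_pdivrMl//; apply: le_trans (@tilt_le _ _ _ (a * t) sq _) _.
  by rewrite mulr_ge0// ltW.
by rewrite mulrBr mulrA lerD2r -scalerA -scalerDr sq.2// ltW.
Qed.

Lemma minimal_sublinear_odd q x : sublinear q ->
  (forall q', sublinear q' -> (forall x, q' x <= q x) -> q' = q) ->
  q (- x) = - q x.
Proof.
move=> sq qmin.
have tq : tilt q x = q.
  apply: qmin; first exact: tilt_sublinear.
  by move=> y; have := tilt_le x y sq (lexx 0);
    rewrite scale0r mul0r addr0 subr0.
apply/eqP; rewrite eq_le; apply/andP; split.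
  rewrite -tq; apply: le_trans (tilt_le x (- x) sq ler01) _.
  by rewrite scale1r addNr sublinear0// mul1r sub0r tq.
by have := @sublinear_geN q q (- x) sq; rewrite opprK; apply.
Qed.

(** Minimality is applied below [tilt p x0] rather than [p]: this forces [F (- x0) <= - p x0], hence
    equality at [x0]. *)
Lemma hahn_banach p x0 : sublinear p ->
  exists F : V -> R, [/\ scalar F, forall x, F x <= p x & F x0 = p x0].
Proof.
move=> sp; have stp := tilt_sublinear x0 sp.
have [F [sF Ftp Fmin]] := minimal_sublinear stp.
have FN x : F (- x) = - F x by exact: minimal_sublinear_odd.
have FD x y : F (x + y) = F x + F y.
  apply/eqP; rewrite eq_le sF.1/= -[leLHS]opprK -[leRHS]opprK lerN2 -FN.
  by rewrite !opprD -!FN; exact: sF.1.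
have Fp x : F x <= p x.
  apply: le_trans (Ftp x) _.
  by have := tilt_le x0 x sp (lexx 0); rewrite scale0r mul0r addr0 subr0.
exists F; split=> //.
- move=> a x y; rewrite FD; congr (_ + _).
  have [a0|/ltW a0] := leP 0 a; first by rewrite sublinearZ.
  by rewrite -[LHS]opprK -FN -scaleNr sublinearZ ?oppr_ge0// mulNr opprK.
- apply/eqP; rewrite eq_le Fp/= -lerN2 -FN.
  apply: le_trans (Ftp _) _; apply: le_trans (tilt_le x0 (- x0) sp ler01) _.
  by rewrite scale1r addNr sublinear0// mul1r sub0r.
Qed.

End HahnBanach.

(** * Representatives in L1, continuous functionals *)

Section LspaceRepresentatives.
Context (R : realType) d (T : measurableType d).
Context (mu : {measure set T -> \bar R}).

Lemma aeEqMfun_measurable (h : {mfun_ mu, T >-> measurableTypeR R}) :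
  measurable_fun setT (h : T -> R).
Proof. exact: (@measurable_funPT _ _ _ _ (repr h)). Qed.

Lemma Lspace1_integrable (h : LspaceType1 mu) :
  mu.-integrable setT (EFin \o (h : T -> R)).
Proof.
apply/integrableP; split; first exact/measurable_EFinP/aeEqMfun_measurable.
have : finite_norm mu 1 (h : T -> R) by exact: Lebesgue_finite.
by rewrite /finite_norm Lnorm1.
Qed.

Lemma ae_eq_integral_norm (g h : T -> R) :
  measurable_fun setT g -> measurable_fun setT h -> g = h %[ae mu] ->
  (\int[mu]_x `|(g x)%:E| = \int[mu]_x `|(h x)%:E|)%E.
Proof.
move=> mg mh gh; apply: ge0_ae_eq_integral => //.
- by apply: measurableT_comp => //; exact/measurable_EFinP.
- by apply: measurableT_comp => //; exact/measurable_EFinP.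
- by apply: filterS gh => x /= /[apply] ->.
Qed.

Lemma Lspace1_of (g : T -> R) : mu.-integrable setT (EFin \o g) ->
  exists h : LspaceType1 mu, (h : T -> R) = g %[ae mu].
Proof.
move=> ig.
have mg : measurable_fun setT (g : T -> measurableTypeR R).
  by apply/measurable_EFinP; exact: (measurable_int mu).
pose g' := HB.pack_for {mfun T >-> measurableTypeR R}
  (g : T -> measurableTypeR R)
  (@isMeasurableFun.Build _ _ _ _ (g : T -> measurableTypeR R) mg).
pose h0 : {mfun_ mu, T >-> measurableTypeR R} := (\pi g')%qT.
have h0g : (h0 : T -> R) = g %[ae mu].
  have : (repr h0 == g' %[mod {mfun_ mu, T >-> measurableTypeR R}])%qT.
    by rewrite reprK.
  by rewrite eqmodE => /asboolP.
have fin : finite_norm mu 1 (h0 : T -> R).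
  rewrite /finite_norm Lnorm1 (ae_eq_integral_norm _ _ h0g)//.
    by have [] := integrableP _ _ _ ig.
  exact: aeEqMfun_measurable.
by exists (HB.pack_for (LspaceType1 mu) h0
  (isFinLebesgue.Build _ _ _ mu _ (lexx 1%E) h0 fin)).
Qed.

Lemma Lspace1_eq (g h : LspaceType1 mu) :
  (g : T -> R) = h %[ae mu] -> g = h.
Proof.
case: g h => [g [[fg]]] [h [[fh]]] /= gh.
have /eqP {}gh := introT (ae_eqP g h) gh; rewrite !reprK in gh; subst h.
by rewrite (Prop_irrelevance fg fh).
Qed.

End LspaceRepresentatives.

Section Scalar.
Context {R : realType} {V : lmodType R}.
Implicit Types (f : V -> R).

Lemma scalar_fun0 f : scalar f -> f 0 = 0.
Proof.
by move=> sf; have := sf (-1) 0 0; rewrite scaleN1r addNr mulN1r addNr.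
Qed.

Lemma scalar_funZ f a x : scalar f -> f (a *: x) = a * f x.
Proof.
by move=> sf; have := sf a x 0; rewrite !addr0 (scalar_fun0 sf) addr0.
Qed.

Lemma scalar_funD f x y : scalar f -> f (x + y) = f x + f y.
Proof. by move=> sf; have := sf 1 x y; rewrite scale1r mul1r. Qed.

Lemma scalar_funN f x : scalar f -> f (- x) = - f x.
Proof. by move=> sf; rewrite -scaleN1r scalar_funZ// mulN1r. Qed.

Lemma scalar_funB f x y : scalar f -> f (x - y) = f x - f y.
Proof. by move=> sf; rewrite scalar_funD// scalar_funN. Qed.

Lemma scalar_fun_sum (I : Type) (s : seq I) (x : I -> V) f : scalar f ->
  f (\sum_(i <- s) x i) = \sum_(i <- s) f (x i).
Proof.
move=> sf; elim: s => [|i s IH]; first by rewrite !big_nil scalar_fun0.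
by rewrite !big_cons scalar_funD// IH.
Qed.

End Scalar.

Section Dual.
Context {R : realType} {X : normedModType R}.
Implicit Types (f g : X -> R).

Lemma dual0 : dual (fun _ : X => 0 : R).
Proof.
by split; [move=> a u v; rewrite mulr0 addr0|move=> x; exact: cvg_cst].
Qed.

Lemma dual_lin a f g : dual f -> dual g -> dual (fun x => a * f x + g x).
Proof.
move=> [sf cf] [sg cg]; split.
  move=> b u v; rewrite sf sg !mulrDr !mulrA (mulrC a b) -!addrA; congr (_ + _).
  by rewrite addrCA.
by move=> x; apply: cvgD; [apply: cvgM; [exact: cvg_cst|exact: cf]|exact: cg].
Qed.

Lemma scalar_bounded_dual f C : scalar f -> (forall x, `|f x| <= C * `|x|) ->
  dual f.
Proof.
move=> sf fC; split=> // x; apply/cvgrPdist_lt => /= e e0; near=> y.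
rewrite -scalar_funB//; apply: le_lt_trans (fC _) _.
(* [C] may be zero or negative, so a positive constant replaces it before dividing. *)
have C1 : 0 < `|C| + 1 by rewrite ltr_wpDl.
apply: (@le_lt_trans _ _ ((`|C| + 1) * `|x - y|)).
  by rewrite ler_wpM2r// (le_trans (ler_norm _))// lerDl.
rewrite -ltr_pdivlMl//; near: y; apply: cvgr_dist_lt => //.
by rewrite mulr_gt0// invr_gt0.
Unshelve. all: by end_near. Qed.

Lemma dual_bounded f : dual f ->
  exists2 C, 0 < C & forall x, `|f x| <= C * `|x|.
Proof.
move=> [sf cf].
have := cf 0 => /cvgrPdist_lt /(_ 1 ltr01); rewrite (scalar_fun0 sf).
move=> /nbhs_ballP [e /= e0 fe].
exists (2 / e) => [|x]; first by rewrite divr_gt0.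
have [->|x0] := eqVneq x 0; first by rewrite (scalar_fun0 sf) !normr0 mulr0.
have nx : 0 < `|x| by rewrite normr_gt0.
(* Rescaled by this factor, [x] has norm [e / 2] and lies in the ball where [f] stays below 1 in
   modulus; hence the constant [2 / e]. *)
have c0 : 0 < e / 2 / `|x| by rewrite !divr_gt0.
have : ball (0 : X) e ((e / 2 / `|x|) *: x).
  rewrite -ball_normE /= sub0r normrN normrZ gtr0_norm// divfK ?gt_eqF//.
  by rewrite ltr_pdivrMr// ltr_pMr// ltr1n.
move=> /fe; rewrite sub0r normrN scalar_funZ// normrM (gtr0_norm c0).
rewrite mulrC -ltr_pdivlMr// => /ltW /le_trans; apply.
by rewrite mul1r !invfM !invrK (mulrC e^-1).
Qed.

Let has_sup_dual f : dual f ->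
  has_sup [set `|f x| | x in [set x : X | `|x| <= 1]].
Proof.
move=> df; have [C C0 fC] := dual_bounded df; split.
  by exists `|f 0|, 0 => //=; rewrite normr0.
exists C => _ [x /= x1 <-]; apply: le_trans (fC x) _.
by rewrite ler_piMr// ltW.
Qed.

Lemma dual_norm_le f x : dual f -> `|f x| <= dual_norm f * `|x|.
Proof.
move=> df; have [->|x0] := eqVneq x 0.
  by rewrite (scalar_fun0 df.1) !normr0 mulr0.
have nx : 0 < `|x| by rewrite normr_gt0.
rewrite -ler_pdivrMr//; apply: ub_le_sup; first by have [] := has_sup_dual df.
exists (`|x|^-1 *: x) => /=.
  by rewrite normrZ normfV normr_id mulVf ?gt_eqF.
by rewrite (scalar_funZ _ _ df.1) normrM normfV normr_id mulrC.
Qed.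

Lemma dual_norm_adherent f e : dual f -> 0 < e ->
  exists2 u : X, `|u| <= 1 & dual_norm f - e < f u.
Proof.
move=> df e0; have [_ [u /= u1 <-] h] := sup_adherent e0 (has_sup_dual df).
have [f0|f0] := leP 0 (f u); first by exists u => //; rewrite -(ger0_norm f0).
by exists (- u); rewrite ?normrN// (scalar_funN _ df.1) -(ltr0_norm f0).
Qed.

Lemma dual_norm_ge0 f : dual f -> 0 <= dual_norm f.
Proof.
move=> df; apply: le_trans (normr_ge0 (f 0)) _.
apply: ub_le_sup; first by have [] := has_sup_dual df.
by exists 0 => //=; rewrite normr0.
Qed.

Lemma dual_norm0_eq0 f x : dual f -> dual_norm f = 0 -> f x = 0.
Proof.
move=> df f0; apply/eqP; rewrite -normr_le0.
by have := dual_norm_le x df; rewrite f0 mul0r.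
Qed.

End Dual.

(** * Transport of mass *)

Section Transport.
Context {R : realDomainType} {I : finType}.
Implicit Types a : I -> R.

(** Unnormalised product coupling of the positive part of [a] with its negative part. The factor 2
    matches the later normalisation by the sum of the [|a k|], twice the mass of either part when
    [a] sums to zero. *)
Definition transport_gain a i j :=
  Num.max (a i) 0 * Num.max (- a j) 0 *+ 2.

Lemma sum_transport_gain a i : \sum_k a k = 0 ->
  \sum_j transport_gain a i j = Num.max (a i) 0 * \sum_k `|a k| /\
  \sum_j transport_gain a j i = Num.max (- a i) 0 * \sum_k `|a k|.
Proof.
move=> a0.
have normE k : `|a k| = Num.max (a k) 0 *+ 2 - a k.
  case: (leP 0 (a k)) => h; first by rewrite ger0_norm// mulr2n addrK.
  by rewrite ltr0_norm// mul0rn sub0r.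
have normE' k : `|a k| = Num.max (- a k) 0 *+ 2 + a k.
  case: (leP 0 (- a k)) => h.
    by rewrite ler0_norm -?oppr_ge0// mulr2n subrK.
  by rewrite gtr0_norm -?oppr_lt0// mul0rn add0r.
have S : \sum_k `|a k| = \sum_k Num.max (- a k) 0 *+ 2.
  by rewrite (eq_bigr _ (fun k _ => normE' k)) big_split/= a0 addr0.
have S' : \sum_k `|a k| = \sum_k Num.max (a k) 0 *+ 2.
  by rewrite (eq_bigr _ (fun k _ => normE k)) sumrB a0 subr0.
rewrite /transport_gain; split.
  by rewrite S mulr_sumr; apply: eq_bigr => j _; rewrite mulrnAr.
rewrite S' mulr_sumr; apply: eq_bigr => j _.
by rewrite mulrnAr mulrC.
Qed.

End Transport.

Section TransportPlan.
Context {R : realFieldType} {I : finType}.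
Implicit Types a : I -> R.

(* When [\sum_k a k = 0], [\sum_k `|a k|] is twice the total mass moved; when it
   vanishes, division by zero returns the plan 0, which is the right one. *)
Definition transport_plan a i j := transport_gain a i j / \sum_k `|a k|.

Lemma transport_plan_ge0 a i j : 0 <= transport_plan a i j.
Proof.
by rewrite divr_ge0 ?sumr_ge0// mulrn_wge0// mulr_ge0// le_max lexx orbT.
Qed.

(** Domination for integrability. No condition is put on the sum of [a], so it also applies on the
    null set where representatives fail to sum to zero. *)
Lemma transport_plan_le a i j : transport_plan a i j <= `|a i| *+ 2.
Proof.
rewrite /transport_plan /transport_gain mulrnAl -mulrA lerMn2r/=.
have [S0|S0] := eqVneq (\sum_k `|a k|) 0.
  by rewrite S0 invr0 !mulr0.
have {}S0 : 0 < \sum_k `|a k| by rewrite lt_def S0 sumr_ge0.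
rewrite -[leRHS]mulr1; apply: ler_pM.
- by rewrite le_max lexx orbT.
- by rewrite divr_ge0 ?(ltW S0)// le_max lexx orbT.
- by rewrite ge_max ler_norm/=.
- rewrite ler_pdivrMr// mul1r ge_max (ltW S0) andbT.
  rewrite (bigD1 j)//= ler_wpDr ?sumr_ge0//.
  by rewrite -normrN ler_norm.
Qed.

Lemma sum_transport_plan a i : \sum_k a k = 0 ->
  \sum_j transport_plan a i j = Num.max (a i) 0 /\
  \sum_j transport_plan a j i = Num.max (- a i) 0.
Proof.
move=> a0; have [e1 e2] := sum_transport_gain i a0.
rewrite /transport_plan -!mulr_suml e1 e2.
have [S0|S0] := eqVneq (\sum_k `|a k|) 0; last by rewrite !mulfK.
(* If the total vanishes, so does [a i], and both sides are 0. *)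
have /eqP := S0; rewrite psumr_eq0// => /allP /(_ i).
rewrite mem_index_enum => /(_ isT) /implyP /(_ isT).
rewrite normr_eq0 => /eqP ->.
by rewrite S0 oppr0 maxxx !mul0r.
Qed.

(** Outgoing mass is the positive part of [a i] and incoming mass the negative part; their
    difference is [a i], and their sum in [transport_planD] is its absolute value. *)
Lemma transport_planB a i : \sum_k a k = 0 ->
  a i = \sum_j (transport_plan a i j - transport_plan a j i).
Proof.
move=> a0; have [e1 e2] := sum_transport_plan i a0; rewrite sumrB e1 e2.
have [h|h] := leP 0 (a i).
  by rewrite max_r ?oppr_le0// subr0.
by rewrite max_l ?oppr_ge0 ?sub0r ?opprK// ltW.
Qed.

Lemma transport_planD a i : \sum_k a k = 0 ->
  `|a i| = \sum_j (transport_plan a i j + transport_plan a j i).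
Proof.
move=> a0; have [e1 e2] := sum_transport_plan i a0; rewrite big_split/= e1 e2.
have [h|h] := leP 0 (a i).
  by rewrite max_r ?oppr_le0// addr0 ger0_norm.
by rewrite max_l ?oppr_ge0 ?add0r ?ltr0_norm// ltW.
Qed.

End TransportPlan.

(** * Functionals represented by integrable functions, and their splitting by transport *)

Section L1Representation.
Context {R : realType} {X : normedModType R} {d : measure_display}
  {T : measurableType d} {mu : {measure set T -> \bar R}}
  {Phi : (X -> R) -> LspaceType1 mu}.
Hypothesis iPhi : L1_isometry Phi.
Implicit Types (f : X -> R) (g : T -> R).

(** [g] is any integrable member of the class [Phi f], so pointwise formulas can be used in place of
    operations on classes. *)
Definition represents f g :=
  [/\ dual f, mu.-integrable setT (EFin \o g) & (Phi f : T -> R) = g %[ae mu]].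

Lemma represents_Phi f : dual f -> represents f (Phi f).
Proof.
by move=> df; split=> //; [exact: Lspace1_integrable|exact: ae_eq_refl].
Qed.

Lemma represents_exists g : mu.-integrable setT (EFin \o g) ->
  exists f, represents f g.
Proof.
move=> ig; have [h hg] := Lspace1_of ig.
have [_ _ /(_ h)[f df fh]] := iPhi.
by exists f; split => //; rewrite fh.
Qed.

Lemma represents_lin a f1 f2 g1 g2 : represents f1 g1 -> represents f2 g2 ->
  represents (fun x => a * f1 x + f2 x) (fun t => a * g1 t + g2 t).
Proof.
move=> [df1 ig1 fg1] [df2 ig2 fg2]; split; first exact: dual_lin.
- rewrite (_ : _ \o _ = (fun t => a%:E * (EFin \o g1) t + (EFin \o g2) t)%E)//.
  by apply: integrableD => //; exact: integrableZl.
- have [/(_ a f1 f2 df1 df2) lin _ _] := iPhi.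
  apply: filterS3 lin fg1 fg2 => t /(_ I) -> /(_ I) e1 /(_ I) e2 _.
  by rewrite e1 e2.
Qed.

Lemma represents0 : represents (fun=> 0) (fun=> 0).
Proof.
have df := @dual0 R X.
(* That [Phi] sends 0 to 0 comes from linearity applied to [-1 * 0 + 0]. *)
have := represents_lin (-1) (represents_Phi df) (represents_Phi df).
under eq_fun do rewrite mulr0 addr0.
by under [X in represents _ X -> _]eq_fun do rewrite mulN1r addNr.
Qed.

Lemma represents_sum (I : Type) (s : seq I) (f : I -> X -> R)
    (g : I -> T -> R) :
  (forall i, represents (f i) (g i)) ->
  represents (fun x => \sum_(i <- s) f i x) (fun t => \sum_(i <- s) g i t).
Proof.
move=> fg; elim: s => [|i s IH].
  have -> : (fun x => \sum_(i <- [::]) f i x) = (fun=> 0).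
    by apply/funext => x; rewrite big_nil.
  have -> : (fun x => \sum_(i <- [::]) g i x) = (fun=> 0).
    by apply/funext => x; rewrite big_nil.
  exact: represents0.
have -> : (fun x => \sum_(i <- i :: s) f i x) =
    (fun x => 1 * f i x + \sum_(i <- s) f i x).
  by apply/funext => x; rewrite big_cons mul1r.
have -> : (fun x => \sum_(i <- i :: s) g i x) =
    (fun x => 1 * g i x + \sum_(i <- s) g i x).
  by apply/funext => x; rewrite big_cons mul1r.
exact: represents_lin.
Qed.

Lemma represents_norm f g : represents f g ->
  (dual_norm f)%:E = (\int[mu]_t `|(g t)%:E|)%E.
Proof.
move=> [df ig fg]; have [_ /(_ f df) <- _] := iPhi; rewrite Lnorm1.
apply: ae_eq_integral_norm => //; first exact: aeEqMfun_measurable.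
by apply/measurable_EFinP; exact: (measurable_int mu).
Qed.

Lemma represents0_eq0 f g x : represents f g ->
  g = (fun=> 0) %[ae mu] -> f x = 0.
Proof.
move=> [df ig fg] g0; apply: dual_norm0_eq0 => //.
apply: EFin_inj; rewrite (@represents_norm f (fun=> 0)).
  by rewrite (eq_integral (cst 0%E)) ?integral0// => t _; rewrite abse0.
by split=> //; [exact: integrable0|exact: ae_eq_trans fg g0].
Qed.

(** Injectivity of [Phi] through norms: [f2 - f1] is represented by a function that is zero almost
    everywhere, so its dual norm is 0. *)
Lemma represents_eq f1 f2 g1 g2 x : represents f1 g1 -> represents f2 g2 ->
  g1 = g2 %[ae mu] -> f1 x = f2 x.
Proof.
move=> r1 r2 g12; apply/esym/eqP; rewrite -subr_eq0 addrC -mulN1r; apply/eqP.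
apply: (represents0_eq0 _ (represents_lin (-1) r1 r2)).
by apply: filterS g12 => t /[apply] ->; rewrite mulN1r addNr.
Qed.

Lemma represents_zero_ae f g : represents f g -> (forall x, f x = 0) ->
  g = (fun=> 0) %[ae mu].
Proof.
move=> fg f0; have ef : f = fun=> 0 by exact/funext.
have [_ _ ae1] := fg; rewrite ef in ae1; have [_ _ ae2] := represents0.
by apply: ae_eq_trans ae2; exact: ae_eq_sym.
Qed.

Lemma measurable_transport_plan (I : finType) (g : I -> T -> R) i j :
  (forall i, measurable_fun setT (g i)) ->
  measurable_fun setT (fun t => transport_plan (g ^~ t) i j).
Proof.
move=> mg; rewrite /transport_plan /transport_gain.
under eq_fun do rewrite -mulr_natr.
apply: measurable_funM.
  apply: measurable_funM => //; apply: measurable_funM.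
    exact: measurable_maxr.
  by apply: measurable_maxr => //; exact: measurableT_comp.
(* The inverse becomes a power with exponent -1, a measurable function; both conventions give 0
   where the sum vanishes. *)
have -> : (fun t => (\sum_k `|g k t|)^-1) =
    (fun t => (\sum_k `|g k t|) `^ (-1)).
  by apply/funext => t; rewrite powR_inv1// sumr_ge0.
apply: (measurableT_comp (measurable_powR (-1))).
by apply: measurable_sum => k; exact: measurableT_comp.
Qed.

Lemma integrable_transport_plan (I : finType) (g : I -> T -> R) i j :
  (forall i, mu.-integrable setT (EFin \o g i)) ->
  mu.-integrable setT (fun t => (transport_plan (g ^~ t) i j)%:E).
Proof.
move=> ig.
have mg k : measurable_fun setT (g k).
  by apply/measurable_EFinP; exact: (measurable_int mu).
apply: (le_integrable measurableT _ _ (integrableZl measurableT 2 (ig i))).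
  by apply/measurable_EFinP; exact: measurable_transport_plan.
move=> t _ /=; rewrite lee_fin ger0_norm ?transport_plan_ge0//.
apply: le_trans (transport_plan_le _ _ _) _.
by rewrite normrM normr_nat mulr_natl.
Qed.

(** The plan is formed pointwise on representatives and pulled back to functionals. Being
    nonnegative, its entries have their integrals as norms, so the pointwise identity for absolute
    values integrates to additivity of norms. *)
Lemma dual_transport (J : finType) (f : J -> X -> R) :
  (forall i, dual (f i)) -> (forall x, \sum_i f i x = 0) ->
  exists H : J -> J -> X -> R, [/\ forall i j, dual (H i j),
    forall i x, f i x = \sum_j (H i j x - H j i x) &
    forall i, dual_norm (f i) = \sum_j (dual_norm (H i j) + dual_norm (H j i))].
Proof.
move=> df f0.
pose g i : T -> R := Phi (f i).
have rg i : represents (f i) (g i) by exact: represents_Phi.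
have ig i : mu.-integrable setT (EFin \o g i) by have [] := rg i.
(* The representatives sum to zero only almost everywhere, so the transport identities below hold
   almost everywhere. *)
have g0 : (fun t => \sum_i g i t) = (fun=> 0) %[ae mu].
  exact: represents_zero_ae (represents_sum (index_enum J) rg) f0.
pose h i j t := transport_plan (g ^~ t) i j.
have /choice[H' rH'] : forall ij : J * J, exists H, represents H (h ij.1 ij.2).
  by move=> ij; apply: represents_exists; exact: integrable_transport_plan.
pose H i j := H' (i, j).
have rH i j : represents (H i j) (h i j) by exact: (rH' (i, j)).
have nH i j : (dual_norm (H i j))%:E = (\int[mu]_t (h i j t)%:E)%E.
  rewrite (represents_norm (rH i j)); apply: eq_integral => t _.
  by rewrite gee0_abs// lee_fin transport_plan_ge0.
have mh i j : measurable_fun setT (EFin \o h i j).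
  by have [_ /(measurable_int mu)] := rH i j.
exists H; split.
- by move=> i j; have [] := rH i j.
- move=> i x.
  have rD j : represents (fun x => -1 * H j i x + H i j x)
    (fun t => -1 * h j i t + h i j t) by exact: represents_lin.
  rewrite (represents_eq x (rg i) (represents_sum (index_enum J) rD)).
    by apply: eq_bigr => j _; rewrite addrC mulN1r.
  apply: filterS g0 => t /(_ I) gt0 _.
  rewrite (transport_planB i gt0).
  by apply: eq_bigr => j _; rewrite addrC mulN1r.
- move=> i; apply: EFin_inj; rewrite (represents_norm (rg i)).
  rewrite (@ge0_ae_eq_integral _ _ _ mu setT _
      (fun t => \sum_j ((h i j t)%:E + (h j i t)%:E))%E)//.
  + rewrite ge0_integral_sum//.
    * rewrite -sumEFin; apply: eq_bigr => j _.
      rewrite ge0_integralD//.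
      - by rewrite EFinD !nH.
      - by move=> t _; rewrite lee_fin transport_plan_ge0.
      - exact: mh.
      - by move=> t _; rewrite lee_fin transport_plan_ge0.
      - exact: mh.
    * by move=> j; apply: emeasurable_funD; exact: mh.
    * by move=> j t _; rewrite adde_ge0// lee_fin transport_plan_ge0.
  + by apply: measurableT_comp => //; have [_ /(measurable_int mu)] := rg i.
  + by apply: emeasurable_sum => j; apply: emeasurable_funD; exact: mh.
  + by move=> t _; apply: sume_ge0 => j _; rewrite adde_ge0// lee_fin
      transport_plan_ge0.
  + apply: filterS g0 => t /(_ I) gt0 _.
    by rewrite abse_EFin (transport_planD i gt0) -sumEFin.
Qed.

End L1Representation.

(** * Intersection of balls *)

Section FiniteIntersection.
Context {R : realType} {X : completeNormedModType R} {I : finType}.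
Variable r : I -> R.
Hypothesis r_gt0 : forall i, 0 < r i.
Implicit Types (y : I -> X) (t : R).

Definition common_scale y :=
  [set t | 0 <= t /\ exists z, forall i, `|y i - z| <= t * r i].

(** Minkowski functional of the set of families [y] whose closed balls of centers [y i] and radii
    [r i] share a point. *)
Definition gauge y := inf (common_scale y).

Lemma common_scale_neq0 y : common_scale y !=set0.
Proof.
exists (\sum_i `|y i| / r i); split.
  by apply: sumr_ge0 => i _; rewrite divr_ge0// ltW.
exists 0 => i; rewrite subr0 -ler_pdivrMr// (bigD1 i)//= lerDl.
by apply: sumr_ge0 => j _; rewrite divr_ge0// ltW.
Qed.

Lemma gauge_le y t z : 0 <= t -> (forall i, `|y i - z| <= t * r i) ->
  gauge y <= t.
Proof.
move=> t0 yz; apply: ge_inf; first by exists 0 => s [].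
by split=> //; exists z.
Qed.

Lemma gauge_sublinear : sublinear gauge.
Proof.
split=> [y1 y2|a y a0].
  apply: le_add_inf; [exact: common_scale_neq0..|].
  move=> s t [s0 [z1 yz1]] [t0 [z2 yz2]].
  apply: (@gauge_le _ _ (z1 + z2)); first exact: addr_ge0.
  move=> i; rewrite opprD [(y1 + y2) i]/(y1 i + y2 i) addrACA mulrDl.
  by apply: le_trans (ler_normD _ _) _; exact: lerD.
move: a0; rewrite le_eqVlt => /predU1P[<-|a0].
  rewrite mul0r scale0r; apply: (@gauge_le _ _ 0) => // i.
  by rewrite [(0 : I -> X) i]/(0 : X) subrr normr0 mul0r.
rewrite -ler_pdivrMl//; apply: lb_le_inf; first exact: common_scale_neq0.
move=> t [t0 [z yz]]; rewrite ler_pdivrMl//.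
apply: (@gauge_le _ _ (a *: z)); first by rewrite mulr_ge0// ltW.
move=> i; rewrite [(a *: y) i]/(a *: y i) -scalerBr normrZ gtr0_norm//.
by rewrite -mulrA ler_pM2l.
Qed.

Let single i (u : X) : I -> X := fun j => if j == i then u else 0.

Lemma sum_singleE y : y = \sum_i single i (y i).
Proof.
apply/funext => j; rewrite fct_sumE (bigD1 j)//= big1 ?addr0.
  by rewrite /single eqxx.
by move=> i ij; rewrite /single eq_sym (negbTE ij).
Qed.

(** The slack [e] is there because the gauge is an infimum that need not be attained: [gauge x <= 1]
    only yields scales below [1 + e]. *)
Lemma finite_balls_approx (x : I -> X) (e : R) : L1_predual X ->
  (forall i j, `|x i - x j| <= r i + r j) -> 0 < e ->
  exists z, forall i, `|x i - z| <= (1 + e) * r i.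
Proof.
move=> [d [T [mu [Phi iPhi]]]] xr e0.
have [F [sF Fq Fx]] := hahn_banach x gauge_sublinear.
pose f i u := F (single i u).
have FE y : F y = \sum_i f i (y i).
  by rewrite {1}[y]sum_singleE scalar_fun_sum.
have singleD i a u v : single i (a *: u + v) = a *: single i u + single i v.
  apply/funext => j.
  rewrite [RHS]/(a *: single i u j + single i v j) /single.
  by case: ifP => // _; rewrite scaler0; exact/esym/addr0.
have sf i : scalar (f i) by move=> a u v; rewrite /f singleD sF.
have f_le i u : f i u <= (r i)^-1 * `|u|.
  apply: le_trans (Fq _) _; apply: (@gauge_le _ _ 0).
    by rewrite mulr_ge0// invr_ge0 ltW.
  move=> j; rewrite subr0 /single; case: eqVneq => [->|_].
    by rewrite mulrAC mulVf ?mul1r// gt_eqF.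
  by rewrite normr0 !mulr_ge0// ?invr_ge0// ltW.
have df i : dual (f i).
  apply: (@scalar_bounded_dual _ _ _ (r i)^-1) (sf i) _ => u.
  rewrite ler_norml f_le andbT lerNl -scalar_funN//.
  by apply: le_trans (f_le _ _) _; rewrite normrN.
(* A constant family has a common point at scale 0, so [F] is nonpositive, hence zero, on constant
   families. *)
have f_sum0 u : \sum_i f i u = 0.
  have le0 v : \sum_i f i v <= 0.
    have <- := FE (fun=> v); apply: le_trans (Fq _) _.
    by apply: (@gauge_le _ _ v) => // i; rewrite subrr normr0 mul0r.
  apply/eqP; rewrite eq_le le0/= -oppr_le0 -sumrN.
  by under eq_bigr do rewrite -scalar_funN//.
(* [F] is tested on families [r i *: u i] with [u i] in the unit ball: the common point 0 shows that
   their gauge is at most 1. *)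
have norm_sum : \sum_i r i * dual_norm (f i) <= 1.
  apply/ler_addgt0Pr => c c0.
  (* An error [c / S] at each index, weighted by [r i], totals at most [c]; the 1 keeps [S] positive
     for an empty index type. *)
  pose S := 1 + \sum_i r i.
  have S0 : 0 < S by rewrite ltr_wpDr ?sumr_ge0// => i _; exact: ltW.
  have cS : 0 < c / S by rewrite divr_gt0.
  have /choice[u ru] : forall i, exists u : X, `|u| <= 1 /\
      dual_norm (f i) - c / S < f i u.
    by move=> i; have [u] := dual_norm_adherent (df i) cS; exists u.
  apply: (@le_trans _ _ (\sum_i (f i (r i *: u i) + r i * (c / S)))).
    apply: ler_sum => i _; rewrite (scalar_funZ _ _ (sf i)) -mulrDr.
    rewrite ler_pM2l// -lerBlDr.
    by have [_ /ltW] := ru i.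
  rewrite big_split/= -FE lerD//.
    apply: le_trans (Fq _) _; apply: (@gauge_le _ _ 0) => // i.
    rewrite subr0 normrZ gtr0_norm// mul1r ler_piMr ?(ltW (r_gt0 i))//.
    by have [] := ru i.
  rewrite -mulr_suml mulrCA ler_piMr ?(ltW c0)// ler_pdivrMr// mul1r.
  by rewrite lerDr.
have [H [dH fH nH]] := dual_transport iPhi df f_sum0.
(* After transport, [gauge x = F x] is the double sum of [H i j (x i - x j)], bounded through the
   distance hypothesis by that of [dual_norm (H i j) * (r i + r j)], which regroups into the sum in
   [norm_sum]. *)
have gx : gauge x <= 1.
  apply: le_trans norm_sum; rewrite -Fx FE.
  have -> : \sum_i f i (x i) = \sum_i \sum_j H i j (x i - x j).
    under eq_bigr do rewrite fH sumrB.
    rewrite sumrB [X in _ - X]exchange_big -sumrB; apply: eq_bigr => i _.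
    rewrite -sumrB; apply: eq_bigr => j _.
    by rewrite (scalar_funB _ _ (dH i j).1).
  have -> : \sum_i r i * dual_norm (f i) =
      \sum_i \sum_j dual_norm (H i j) * (r i + r j).
    under eq_bigr do rewrite nH big_split mulrDr !mulr_sumr.
    rewrite big_split/= [X in _ + X]exchange_big -big_split/=.
    apply: eq_bigr => i _; rewrite -big_split/=; apply: eq_bigr => j _.
    by rewrite mulrDr [_ * r i]mulrC [_ * r j]mulrC.
  apply: ler_sum => i _; apply: ler_sum => j _.
  apply: le_trans (ler_norm _) _; apply: le_trans (dual_norm_le _ (dH i j)) _.
  by rewrite ler_wpM2l ?dual_norm_ge0.
have hi : has_inf (common_scale x).
  by split; [exact: common_scale_neq0|exists 0 => s []].
have [t [t0 [z xz]] te] := inf_adherent e0 hi.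
exists z => i; apply: le_trans (xz i) _; rewrite ler_pM2r//.
by apply: le_trans (ltW te) _; rewrite lerD2r.
Qed.

End FiniteIntersection.

(** * From finitely many balls to compact families *)

Section CompactIntersection.
Context {R : realType} {X : completeNormedModType R}.

Lemma pow2_archi (a e : R) : 0 < e -> exists n, a / 2 ^+ n < e.
Proof.
move=> e0; pose n := Num.bound (`|a| / e); exists n.
have p0 : 0 < 2 ^+ n :> R by rewrite exprn_gt0.
rewrite ltr_pdivrMr// -ltr_pdivrMl// mulrC.
apply: (@le_lt_trans _ _ (`|a| / e)).
  by rewrite ler_pM2r ?invr_gt0// ler_norm.
apply: (@lt_trans _ _ n%:R).
  by rewrite archi_boundP// divr_ge0// ltW.
by rewrite -natrX ltr_nat ltn_expl.
Qed.

Lemma geometric_steps_limit (y : nat -> X) (C : R) :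
  (forall n, `|y n.+1 - y n| <= C / 2 ^+ n) ->
  exists l, forall n, `|l - y n| <= C *+ 2 / 2 ^+ n.
Proof.
move=> yC.
(* The exact partial sum of the geometric series is kept, since the bound without the subtracted
   tail would not pass through the induction. *)
have dist n k : `|y (n + k)%N - y n| <= C *+ 2 / 2 ^+ n - C *+ 2 / 2 ^+ (n + k).
  elim: k => [|k IH]; first by rewrite addn0 !subrr normr0.
  rewrite addnS -(subrKA (y (n + k)%N)).
  apply: le_trans (ler_normD _ _) _; apply: le_trans (lerD (yC _) IH) _.
  rewrite addrCA lerD2l exprS invfM mulrA -[C *+ 2]mulr_natr mulfK//.
  by rewrite mulr_natr mulrnAl mulr2n opprD addrA subrr sub0r.
have C0 : 0 <= C.
  by have := le_trans (normr_ge0 _) (yC 0%N); rewrite expr0 divr1.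
have distle n m : (n <= m)%N -> `|y m - y n| <= C *+ 2 / 2 ^+ n.
  move=> nm; rewrite -(subnKC nm); apply: le_trans (dist _ _) _.
  by rewrite lerBlDr lerDl divr_ge0 ?mulrn_wge0// exprn_ge0.
have cy : cvgn y.
  apply: cauchy_cvg; apply: cauchy_exP => e e0.
  have [N Ne] := pow2_archi (C *+ 2) e0.
  exists (y N); exists N => // m /= Nm.
  rewrite -ball_normE /= distrC; exact: le_lt_trans (distle _ _ Nm) Ne.
exists (limn y) => n.
have cn : `|y m - y n| @[m --> \oo] --> `|limn y - y n|.
  by apply: cvg_norm; apply: cvgB => //; exact: cvg_cst.
by apply: (cvgr_to_le cn); exists n => // m /= nm; exact: distle.
Qed.

Lemma compact_net (F : set X) (e : R) : compact F -> 0 < e ->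
  exists D : {fset X}, (forall u, u \in D -> F u) /\
    forall z, F z -> exists2 u, u \in D & `|z - u| < e.
Proof.
move=> + e0; rewrite compact_cover => /(_ X F (fun u => ball u e)).
case=> [u _|z Fz|D DF FD]; first exact: ball_open.
  by exists z => //; exact: ballxx.
exists D; split=> [u /DF|z /FD [u /= uD]]; first exact: set_mem.
by rewrite -ball_normE /= distrC => zu; exists u.
Qed.

Lemma compact_balls_approx (F : set X) (x : X) (r s e : R) :
  L1_predual X -> compact F -> 0 <= r -> 0 <= s -> 0 < e ->
  (forall z z', F z -> F z' -> `|z - z'| <= r *+ 2) ->
  (forall z, F z -> `|x - z| <= r + s) ->
  exists y, (forall z, F z -> `|y - z| <= r + e) /\ `|y - x| <= s + e.
Proof.
move=> preX cF r0 s0 e0 Fr Fx.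
have e3 : 0 < e / 3 by rewrite divr_gt0.
have [D [DF netD]] := compact_net cF e3.
pose c (i : option D) := if i is Some u then val u else x.
(* These local radii, not Chebyshev radii, are enlarged to be positive even when [r] or [s] is 0.
   [None] indexes the extra ball around [x]. The other two thirds of [e] go to the relative slack
   [t] and the net. *)
pose rad (i : option D) := (if i is Some _ then r else s) + e / 3.
have rad0 (i : option D) : 0 < rad i by case: i => [u|]; rewrite /rad ltr_wpDl.
have FD (u : D) : F (val u) by apply: DF; exact: valP.
have crad i j : `|c i - c j| <= rad i + rad j.
  rewrite /rad addrACA; apply: ler_wpDr; first by rewrite addr_ge0// ltW.
  case: i j => [u|] [v|] /=; first by rewrite -mulr2n; apply: Fr; exact: FD.
  - by rewrite distrC; apply: Fx; exact: FD.
  - by rewrite addrC; apply: Fx; exact: FD.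
  - by rewrite subrr normr0 addr_ge0.
pose t := e / 3 / (r + s + e / 3).
have d0 : 0 < r + s + e / 3 by rewrite ltr_wpDl// addr_ge0.
have t0 : 0 < t by rewrite divr_gt0.
have trad (i : option D) : t * rad i <= e / 3.
  rewrite /t mulrAC ler_pdivrMr// ler_pM2l// /rad lerD2r.
  by case: i => [u|]; rewrite ?lerDl ?lerDr.
have [y yc] := finite_balls_approx rad0 preX crad t0.
have {}yc i : `|y - c i| <= rad i + e / 3.
  rewrite distrC; apply: le_trans (yc i) _.
  by rewrite mulrDl mul1r lerD2l.
exists y; split=> [z Fz|]; last first.
  by apply: le_trans (yc None) _; rewrite /rad -addrA lerD2l; lra.
have [u uD zu] := netD z Fz.
have := yc (Some [` uD]%fset); rewrite /= => yu.
rewrite -(subrKA u); apply: le_trans (ler_normD _ _) _.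
rewrite (distrC u); have := lerD yu (ltW zu); rewrite /rad => /le_trans; apply.
lra.
Qed.

Lemma compact_balls (F : set X) (x : X) (r s e : R) :
  L1_predual X -> compact F -> 0 <= r -> 0 <= s -> 0 < e ->
  (forall z z', F z -> F z' -> `|z - z'| <= r *+ 2) ->
  (forall z, F z -> `|x - z| <= r + s) ->
  exists y, (forall z, F z -> `|y - z| <= r) /\ `|y - x| <= s + e.
Proof.
move=> preX cF r0 s0 e0 Fr Fx.
(* The first approximation costs [c 0] beyond [s], and the limit is within [4 * c 0] of it: in all
   [5 * c 0 = e]. *)
pose c n : R := e / 5 / 2 ^+ n.
have c0 n : 0 < c n by rewrite divr_gt0 ?exprn_gt0// divr_gt0.
have cS n : c n.+1 <= c n.
  rewrite /c exprS invfM mulrA ler_pM2r ?invr_gt0 ?exprn_gt0//; lra.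
pose good n y := forall z, F z -> `|y - z| <= r + c n.
(* The approximate result is reapplied around the current point with [c n] as second radius: a small
   move halves the excess over [r]. Goodness is a premise so that [next] is total. *)
have /choice[next nextP] : forall ny : nat * X, exists y', good ny.1 ny.2 ->
    good ny.1.+1 y' /\ `|y' - ny.2| <= c ny.1 + c ny.1.+1.
  move=> [n y] /=; have [gy|ngy] := pselect (good n y); last by exists y.
  have [y' ?] :=
    compact_balls_approx preX cF r0 (ltW (c0 n)) (c0 n.+1) Fr gy.
  by exists y'.
have [y0 [good0 y0x]] := compact_balls_approx preX cF r0 s0 (c0 0%N) Fr Fx.
pose fix y n := if n is n'.+1 then next (n', y n') else y0.
have goody n : good n (y n).
  by elim: n => //= n IH; have [] := nextP (n, y n) IH.
have stepy n : `|y n.+1 - y n| <= (e / 5) *+ 2 / 2 ^+ n.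
  have [_ /= h] := nextP (n, y n) (goody n); apply: le_trans h _.
  by rewrite mulrnAl mulr2n lerD2l.
have [l ly] := geometric_steps_limit stepy.
have {}ly n : `|l - y n| <= c n *+ 4.
  by apply: le_trans (ly n) _; rewrite -mulrnA mulrnAl.
exists l; split=> [z Fz|].
  apply/ler_addgt0Pr => d d0.
  have [n nd] := pow2_archi e d0.
  rewrite -(subrKA (y n)); apply: le_trans (ler_normD _ _) _.
  apply: le_trans (lerD (ly n) (goody n z Fz)) _.
  have cn : c n * 5 = e / 2 ^+ n by rewrite /c mulrAC divfK.
  rewrite -mulr_natr; lra.
rewrite -(subrKA (y 0%N)); apply: le_trans (ler_normD _ _) _.
apply: le_trans (lerD (ly 0%N) y0x) _.
rewrite /c expr0 divr1 -mulr_natr; lra.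
Qed.

End CompactIntersection.

(** * Centers *)

Section Centers.
Context {R : realType} {X : normedModType R}.
Implicit Types (F B : set X) (x y z : X).

Lemma farthest_ge F x z : compact F -> F z -> `|x - z| <= farthest x F.
Proof.
move=> /compact_bounded [M [Mreal FM]] Fz; apply: ub_le_sup; last by exists z.
exists (`|x| + (`|M| + 1)) => _ [w Fw <-]; apply: le_trans (ler_normB _ _) _.
by rewrite lerD2l; apply: FM Fw; rewrite (le_lt_trans (ler_norm M))// ltrDl.
Qed.

Lemma farthest_le F x (c : R) : F !=set0 -> (forall z, F z -> `|x - z| <= c) ->
  farthest x F <= c.
Proof.
move=> [z Fz] Fc; apply: ge_sup; first by exists `|x - z|, z.
by move=> _ [w Fw <-]; exact: Fc.
Qed.

Lemma farthest_ge0 F x : compact F -> F !=set0 -> 0 <= farthest x F.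
Proof. by move=> cF [z Fz]; exact: le_trans (farthest_ge x cF Fz). Qed.

Lemma rad_ge F (c : R) : (forall x, c <= farthest x F) -> c <= rad F.
Proof.
move=> Fc; apply: lb_le_inf; first by exists (farthest (0 : X) F), (0 : X).
by move=> _ [x _ <-].
Qed.

Lemma rad_le_farthest F x : compact F -> F !=set0 -> rad F <= farthest x F.
Proof.
move=> cF F0; apply: ge_inf; last by exists x.
by exists 0 => _ [y _ <-]; exact: farthest_ge0.
Qed.

Lemma rad_ge0 F : compact F -> F !=set0 -> 0 <= rad F.
Proof. by move=> cF F0; apply: rad_ge => x; exact: farthest_ge0. Qed.

Lemma centP F x : compact F -> F !=set0 ->
  cent F x <-> forall z, F z -> `|x - z| <= rad F.
Proof.
move=> cF F0; split=> [<- z|xr]; first exact: farthest_ge.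
by apply/eqP; rewrite eq_le rad_le_farthest// farthest_le.
Qed.

(** Both points lie within [farthest x F] of every [x]. This supplies the diameter condition of
    [compact_balls]. *)
Lemma dist_le_rad F z z' : compact F -> F z -> F z' -> `|z - z'| <= rad F *+ 2.
Proof.
move=> cF Fz Fz'; rewrite -mulr_natr -ler_pdivrMr//; apply: rad_ge => x.
rewrite ler_pdivrMr// -(subrKA x); apply: le_trans (ler_normD _ _) _.
by rewrite mulr_natr mulr2n (distrC z) lerD// farthest_ge.
Qed.

Lemma enlargeP B (a : R) y : 0 < a ->
  enlarge B a y <-> exists2 b, B b & `|y - b| < a.
Proof.
move=> a0; split.
  move=> [b Bb [u]]; rewrite -ball_normE /= sub0r normrN => u1 <-.
  exists b => //; rewrite addrC addKr normrZ gtr0_norm// -[ltRHS]mulr1.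
  by rewrite ltr_pM2l.
move=> [b Bb yb]; exists b => //; exists (a^-1 *: (y - b)).
  rewrite -ball_normE /= sub0r normrN normrZ gtr0_norm ?invr_gt0//.
  by rewrite ltr_pdivrMl// mulr1.
by rewrite scalerA mulfV ?gt_eqF// scale1r addrC subrK.
Qed.

Lemma rad_le_enlarge F1 F2 (a : R) : compact F1 -> F1 !=set0 -> compact F2 ->
  F2 !=set0 -> 0 < a -> F1 `<=` enlarge F2 a -> rad F1 <= rad F2 + a.
Proof.
move=> c1 n1 c2 n2 a0 F12; rewrite -lerBlDr; apply: rad_ge => x.
rewrite lerBlDr; apply: le_trans (rad_le_farthest x c1 n1) _.
apply: farthest_le => // z /F12 /(enlargeP _ _ a0)[b Fb zb].
rewrite -(subrKA b); apply: le_trans (ler_normD _ _) _.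
by rewrite lerD ?farthest_ge// distrC ltW.
Qed.

End Centers.

(** * The Lipschitz estimate for centers *)

(** One [a] comes from replacing a point of [F2] by a nearby point of [F1], the other from
    [rad F1 <= rad F2 + a]. The excess [e] is halved because [enlarge] uses open balls. *)
Lemma cent_enlarge (R : realType) (X : completeNormedModType R) (F1 F2 : set X)
    (a e : R) : L1_predual X -> compact F1 -> F1 !=set0 -> compact F2 ->
  F2 !=set0 -> 0 < a -> F1 `<=` enlarge F2 a -> F2 `<=` enlarge F1 a ->
  0 < e -> cent F1 `<=` enlarge (cent F2) (a *+ 2 + e).
Proof.
move=> preX c1 n1 c2 n2 a0 F12 F21 e0 x /(centP _ c1 n1) x1.
have a2 : 0 <= a *+ 2 by rewrite mulrn_wge0// ltW.
have e2 : 0 < e / 2 by rewrite divr_gt0.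
have [||y [y2 yx]] := @compact_balls _ _ F2 x (rad F2) (a *+ 2) _ preX c2
  (rad_ge0 c2 n2) a2 e2.
- by move=> z z' Fz Fz'; exact: dist_le_rad.
- move=> z /F21 /(enlargeP _ _ a0)[b Fb zb].
  rewrite -(subrKA b); apply: le_trans (ler_normD _ _) _.
  rewrite (distrC b); have := rad_le_enlarge c1 n1 c2 n2 a0 F12.
  by have := x1 b Fb; move: (ltW zb); rewrite mulr2n; lra.
apply/enlargeP; first by rewrite ltr_wpDl.
exists y; first exact/centP.
by rewrite distrC (le_lt_trans yx)// ltrD2l; lra.
Qed.

Lemma L1_predual_cent_lipschitz (R : realType) (X : completeNormedModType R) :
  L1_predual X -> cent_lipschitz X 2.
Proof.
move=> preX F1 F2 c1 n1 c2 n2.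
rewrite -lee_pdivrMl//; apply/ereal_infP => _ [a [a0 F12 F21] <-].
rewrite lee_pdivrMl//; apply/lee_addgt0Pr => e e0.
apply: ge_ereal_inf; exists (a *+ 2 + e)%:E; last first.
  by rewrite EFinD -[a *+ 2]mulr_natl EFinM.
exists (a *+ 2 + e) => //; split; first by rewrite ltr_wpDl// mulrn_wge0// ltW.
  exact: cent_enlarge.
exact: cent_enlarge.
Qed.

(** * The plane with the sup norm *)

(* [mx_complete] already makes matrices complete; redeclaring it over a
   [realType] is what lets the join with the normed structure be inferred. *)
HB.instance Definition _ (R : realType) (m n : nat) :=
  Uniform_isComplete.Build 'M[R]_(m, n) (@mx_complete R m n).

Section Plane.
Context {R : realType}.
Implicit Types (a b c : R) (x : 'rV[R]_2) (f : 'rV[R]_2 -> R).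

Definition pt a b : 'rV[R]_2 := \row_i (if i == 0 then a else b).

Lemma pt_eta x : x = pt (x 0 0) (x 0 1).
Proof.
apply/rowP => i; rewrite mxE; case: eqVneq => [->//|i0].
by congr (x 0 _); apply/val_inj; case: i i0 => [[|[|]]].
Qed.

Lemma pt_norm_le a b c : (`|pt a b| <= c) = (`|a| <= c) && (`|b| <= c).
Proof.
rewrite [leLHS]mx_normrE; apply/idP/idP => [|/andP[ac bc]].
  move=> /bigmax_leP[_ h]; have := h (0, 0) isT; have := h (0, 1) isT.
  by rewrite !mxE/= => -> ->.
apply/bigmax_leP; split; first exact: le_trans ac.
by move=> i _; rewrite mxE; case: ifP.
Qed.

Lemma coord0_le x : `|x 0 0| <= `|x|.
Proof. by have := lexx `|x|; rewrite {1}(pt_eta x) pt_norm_le => /andP[]. Qed.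

Lemma coord1_le x : `|x 0 1| <= `|x|.
Proof. by have := lexx `|x|; rewrite {1}(pt_eta x) pt_norm_le => /andP[]. Qed.

Lemma ptB a b a' b' : pt a b - pt a' b' = pt (a - a') (b - b').
Proof. by apply/rowP => i; rewrite !mxE; case: ifP. Qed.

Lemma scalar_pt f a b : scalar f ->
  f (pt a b) = a * f (pt 1 0) + b * f (pt 0 1).
Proof.
move=> sf; rewrite -(scalar_funZ b _ sf) -sf; congr f.
by apply/rowP => i; rewrite !mxE; case: ifP => _;
  rewrite !(mulr1, mulr0, addr0, add0r).
Qed.

Lemma dual_coord a b : dual (fun x => x 0 0 * a + x 0 1 * b).
Proof.
apply: (@scalar_bounded_dual _ _ _ (`|a| + `|b|)).
  move=> c x y; rewrite !mxE; ring.
move=> x; apply: le_trans (ler_normD _ _) _.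
rewrite !normrM [leRHS]mulrC mulrDr.
by rewrite lerD// ler_wpM2r// ?coord0_le ?coord1_le.
Qed.

(** Duality of the sup norm and the sum norm; the vector of signs of the two coefficients attains
    the supremum. *)
Lemma dual_norm_pt f : dual f -> dual_norm f = `|f (pt 1 0)| + `|f (pt 0 1)|.
Proof.
move=> df; apply/eqP; rewrite eq_le; apply/andP; split.
  apply: ge_sup; first by exists `|f 0|, 0 => //=; rewrite normr0.
  move=> _ [x /= x1 <-]; rewrite {1}(pt_eta x) (scalar_pt _ _ df.1).
  apply: le_trans (ler_normD _ _) _; rewrite !normrM.
  by rewrite lerD// ler_piMl// (le_trans _ x1)// ?coord0_le ?coord1_le.
pose u := pt (Num.sg (f (pt 1 0))) (Num.sg (f (pt 0 1))).
have u1 : `|u| <= 1 by rewrite pt_norm_le !normr_sg !lern1 !leq_b1.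
have := dual_norm_le u df; rewrite {1}/u scalar_pt; last exact: df.1.
rewrite -!normrEsg ger0_norm ?addr_ge0// => /le_trans; apply.
by rewrite ler_piMr// dual_norm_ge0.
Qed.

(** Counting measure on two points, whose L1 space is the plane with the sum norm. *)
Definition two_point : {measure set bool -> \bar R} :=
  measure_add (dirac true) (dirac false).

Lemma measurable_bool (g : bool -> R) : measurable_fun setT g.
Proof. by []. Qed.

Lemma integral_two_point (g : bool -> R) :
  (\int[two_point]_t `|(g t)%:E| = (`|g true| + `|g false|)%:E)%E.
Proof.
have mg : measurable_fun setT (fun t => `|(g t)%:E|%E).
  by apply: measurableT_comp => //; exact/measurable_EFinP/measurable_bool.
by rewrite ge0_integral_measure_add// !integral_dirac// !diracT !mul1e.
Qed.

Lemma integrable_two_point (g : bool -> R) :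
  two_point.-integrable setT (EFin \o g).
Proof.
apply/integrableP; split; first exact/measurable_EFinP/measurable_bool.
by rewrite integral_two_point ltry.
Qed.

Lemma L1_predual_plane : L1_predual 'rV[R]_2.
Proof.
pose coef f (b : bool) := if b then f (pt 1 0) else f (pt 0 1).
have /choice[Phi PhiE] f := Lspace1_of (integrable_two_point (coef f)).
exists _, bool, two_point, Phi; split.
- move=> a f g df dg.
  apply: filterS3 (PhiE f) (PhiE g) (PhiE (fun x => a * f x + g x)).
  move=> b /(_ I) -> /(_ I) -> /(_ I) -> _; by case: b.
- move=> f df; rewrite dual_norm_pt// Lnorm1.
  by rewrite (ae_eq_integral_norm _ _ (PhiE f)) ?integral_two_point.
- move=> h; pose f (x : 'rV[R]_2) := x 0 0 * h true + x 0 1 * h false.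
  exists f; first exact: dual_coord.
  apply: Lspace1_eq; apply: filterS (PhiE f) => b /[apply] ->.
  by case: b; rewrite /coef /f !mxE/= !(mul1r, mul0r, addr0, add0r).
Qed.

Definition pt_set1 : set 'rV[R]_2 := [set pt 0 0].

Definition pt_set2 : set 'rV[R]_2 := [set pt 1 1] `|` [set pt (-1) 1].

Lemma pt_sets_compact :
  [/\ compact pt_set1, pt_set1 !=set0, compact pt_set2 & pt_set2 !=set0].
Proof.
split; [exact: compact_set1|by exists (pt 0 0)| |by exists (pt 1 1); left].
by apply: finite_compact; rewrite finite_setU.
Qed.

Lemma hausdorff_dist_pt_sets : (hausdorff_dist pt_set1 pt_set2 <= 1)%E.
Proof.
apply/lee_addgt0Pr => e e0; apply: ge_ereal_inf; exists (1 + e)%:E => //.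
have e1 : 0 < 1 + e by rewrite addr_gt0.
have n1 a b : `|a| = 1 -> `|b| = 1 -> `|pt a b| < 1 + e.
  move=> a1 b1; apply: (@le_lt_trans _ _ 1); last by rewrite ltrDl.
  by rewrite pt_norm_le a1 b1 lexx.
exists (1 + e) => //; split=> // [_ -> | _ [] ->]; apply/enlargeP => //.
- by exists (pt 1 1); [left | rewrite ptB n1// sub0r normrN1].
- by exists (pt 0 0) => //; rewrite ptB n1// subr0 normr1.
- by exists (pt 0 0) => //; rewrite ptB n1// subr0 ?normrN1 ?normr1.
Qed.

Lemma hausdorff_dist_cent_pt_sets :
  (2%:E <= hausdorff_dist (cent pt_set1) (cent pt_set2))%E.
Proof.
have [c1 n1 c2 n2] := pt_sets_compact.
apply/ereal_infP => _ [a [a0 _ c21] <-]; rewrite lee_fin.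
(* The two points of [pt_set2] are at distance 2, which forces the radius to be at least 1. *)
have r2 : 1 <= rad pt_set2.
  have := dist_le_rad c2 (or_introl erefl : pt_set2 (pt 1 1)) (or_intror erefl).
  rewrite ptB subrr => h.
  have : `|1 - -1 : R| <= rad pt_set2 *+ 2.
    by have := le_trans (coord0_le _) h; rewrite mxE.
  by rewrite opprK ger0_norm ?ler0n// -mulr2n lerMn2r.
(* This point is at sup distance 1 from both points of [pt_set2], and at distance 2 from the origin,
   the only center of [pt_set1]. *)
have : cent pt_set2 (pt 0 2).
  apply/centP => // _ [] ->; rewrite ptB pt_norm_le sub0r.
    rewrite normrN normr1 r2/= (_ : 2 - 1 = 1) ?normr1//; ring.
  rewrite opprK normr1 r2/= (_ : 2 - 1 = 1) ?normr1//; ring.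
move=> /c21 /(enlargeP _ _ a0)[b /(centP _ c1 n1)/(_ _ erefl) b0 ba].
have r1 : rad pt_set1 <= 0.
  apply: le_trans (rad_le_farthest (pt 0 0) c1 n1) _.
  by apply: farthest_le => // _ ->; rewrite subrr normr0.
have := le_trans b0 r1; rewrite normr_le0 subr_eq0 => /eqP bE.
move: ba; rewrite bE ptB !subr0 => ba.
have := le_trans (coord1_le _) (ltW ba); rewrite mxE/=.
by rewrite ger0_norm.
Qed.

End Plane.

Lemma not_cent_lipschitz_plane (R : realType) (c : R) : c < 2 ->
  ~ cent_lipschitz 'rV[R]_2 c.
Proof.
move=> c2 lip; have [k1 n1 k2 n2] := @pt_sets_compact R.
have := le_trans (@hausdorff_dist_cent_pt_sets R) (lip _ _ k1 n1 k2 n2).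
have := @hausdorff_dist_pt_sets R.
have : (0 <= hausdorff_dist (@pt_set1 R) pt_set2)%E.
  by apply/ereal_infP => _ [a [/ltW a0 _ _] <-]; rewrite lee_fin.
case: hausdorff_dist => [h| |]//; rewrite !lee_fin => h0 h1.
(* With the distance [h] between 0 and 1, [c * h] is at most [c] for nonnegative [c] and at most 0
   otherwise, hence below 2 in both cases. *)
have [c0|/ltW c0] := leP 0 c.
  by move=> /le_trans/(_ (ler_piMr c0 h1)); rewrite leNgt c2.
by move=> /le_trans/(_ (mulr_le0_ge0 c0 h0)); rewrite lern0.
Qed.

Theorem theorem3p10 (R : realType) :
  (forall X : completeNormedModType R, L1_predual X -> cent_lipschitz X 2) /\
  (forall c : R, c < 2 ->
     ~ (forall X : completeNormedModType R,
          L1_predual X -> cent_lipschitz X c)).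
Proof.
split=> [X|c c2 lip]; first exact: L1_predual_cent_lipschitz.
exact: (not_cent_lipschitz_plane c2 (lip _ L1_predual_plane)).
Qed.
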